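(* There exist two universal constants $C>0$ and $D>0$ with the following property. Let $X$ be a random variable with values in $\mathbb{N}$ and distribution $\mu$, let $\lambda,\tau>0$, and suppose that for all $\xi\in\mathbb{R}$ $$\mathbb{E}[e^{i\xi X}]\,e^{-\lambda(e^{i\xi}-1)} = 1+\sum_{s=2}^\infty b_s\,(e^{i\xi}-1)^s,\qquad\text{with } |b_s|\le \left(\frac{\tau}{\sqrt{s}}\right)^{s}\ \text{ for all } s\ge 2.$$ Let $r\ge 1$ and let $\nu^{(r)}$ be the approximation scheme of order $r$ of $\mu$, i.e. the signed measure on $\mathbb{N}$ whose Fourier transform is $$\widehat{\nu}^{(r)}(\xi)=e^{\lambda(e^{i\xi}-1)}\left(1+\sum_{s=2}^r b_s\,(e^{i\xi}-1)^s\right).$$ If $\varepsilon=\frac{D\tau}{\sqrt{\lambda}}<1$, then $$d_{\mathrm{TV}}(\mu,\nu^{(r)})\le C\,\varepsilon^{r+1}.$$ Moreover, if $D=4$, then one can take $C\le 570$.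
   Context: $\mathbb{N}=\{0,1,2,\ldots\}$. The Fourier transform of a (finite) signed measure $\nu$ on $\mathbb{N}$ is $\widehat{\nu}(\xi)=\sum_{k\in\mathbb{N}}\nu(k)e^{ik\xi}$. For signed measures $\mu,\nu$ on $\mathbb{N}$, $d_{\mathrm{TV}}(\mu,\nu)=\frac12\sum_{k\in\mathbb{N}}|\mu(k)-\nu(k)|$. For $r=1$ the empty sum is $0$, so $\nu^{(1)}$ is the Poisson law of parameter $\lambda$. ''Universal'' means that $C$ and $D$ depend on none of $X,\lambda,\tau,r$. *)

(* Defs.v *)
From HB Require Import structures.
From mathcomp Require Import all_boot all_order all_algebra.
From mathcomp Require Import complex.
From mathcomp Require Import all_classical all_reals all_analysis.

Set Implicit Arguments.
Unset Strict Implicit.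
Unset Printing Implicit Defensive.

Import Order.TTheory GRing.Theory Num.Theory.
Import numFieldNormedType.Exports.

Local Open Scope classical_set_scope.
Local Open Scope ring_scope.
Local Open Scope complex_scope.

(* exp(x + iy) = e^x (cos y + i sin y) *)
Definition cexp (R : realType) (z : R[i]) : R[i] :=
  (expR (complex.Re z))%:C * (cos (complex.Im z) +i* sin (complex.Im z)).

Definition expi (R : realType) (x : R) : R[i] := cexp (0 +i* x).

(* The extended-real expectations below are finite whenever Z is measurable
   and bounded, so that [fine] loses nothing for Z = e^{i xi X}. *)
Definition cexpectation (d : measure_display) (T : measurableType d)
    (R : realType) (P : probability T R) (Z : T -> R[i]) : R[i] :=
  fine 'E_P[fun w => complex.Re (Z w)] +i* fine 'E_P[fun w => complex.Im (Z w)].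

(* R[i]^o carries the topology of the complex modulus (R[i] itself has none).
   For a charge nu the atoms [nu [set k]] are finite and the series converges
   absolutely, so [fine] and [limn] never take their default values. *)
Definition fourier (R : realType) (nu : set nat -> \bar R) (xi : R) : R[i] :=
  limn ((fun n : nat =>
    \sum_(0 <= k < n) (fine (nu [set k]))%:C * expi (k%:R * xi))
    : nat -> R[i]^o).

Definition dTV (R : realType) (mu nu : set nat -> \bar R) : \bar R :=
  (2^-1%:E * \sum_(0 <= k <oo) `| mu [set k] - nu [set k] |)%E.

(* E[e^{i xi X}] e^{-lambda(e^{i xi}-1)} = 1 + sum_{s >= 2} b_s (e^{i xi}-1)^s,
   together with |b_s| <= (tau / sqrt s)^s; the equality is convergence of the
   partial sums. The b_s are not assumed real; the last inequality is in R[i],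
   both sides being (embeddings of) real numbers. *)
Definition residue_expansion (d : measure_display) (T : measurableType d)
    (R : realType) (P : probability T R) (X : {RV P >-> nat})
    (lambda tau : R) (b : nat -> R[i]) : Prop :=
  (forall xi : R,
    ((fun n : nat => 1 + \sum_(2 <= s < n) b s * (expi xi - 1) ^+ s)
      : nat -> R[i]^o) @ \oo -->
    (cexpectation P (fun w => expi (xi * (X w)%:R))
     * cexp (- (lambda%:C * (expi xi - 1))) : R[i]^o)) /\
  (forall s : nat, (2 <= s)%N ->
    `|b s| <= ((tau / Num.sqrt (s%:R)) ^+ s)%:C).

(* nu is a finite signed measure on nat with the Fourier transform
   e^{lambda(e^{i xi}-1)} (1 + sum_{s=2}^r b_s (e^{i xi}-1)^s), which
   determines nu; the sum is empty for r = 1. *)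
Definition approximation_scheme (R : realType) (lambda : R) (b : nat -> R[i])
    (r : nat) (nu : {charge set nat -> \bar R}) : Prop :=
  forall xi : R,
    fourier nu xi =
    cexp (lambda%:C * (expi xi - 1)) *
    (1 + \sum_(2 <= s < r.+1) b s * (expi xi - 1) ^+ s).

Definition TV_bound (R : realType) (C D : R) : Prop :=
  forall (d : measure_display) (T : measurableType d) (P : probability T R)
    (X : {RV P >-> nat}) (lambda tau : R) (b : nat -> R[i])
    (r : nat) (nu : {charge set nat -> \bar R}),
  0 < lambda -> 0 < tau ->
  residue_expansion X lambda tau b ->
  (1 <= r)%N ->
  approximation_scheme lambda b r nu ->
  D * tau / Num.sqrt lambda < 1 ->
  (dTV (distribution P X) nu <=
     (C * (D * tau / Num.sqrt lambda) ^+ r.+1)%:E)%E.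

(* Main.v *)
Require Import Defs.
From mathcomp Require Import all_boot all_order all_algebra.
From mathcomp Require Import complex zify ring lra.
From mathcomp Require Import all_classical all_reals all_analysis.

(** Write [z = e^{ix} - 1].  The Fourier transform of [mu - nu] is
    [e^{lambda z} * sum_{s > r} b_s z^s], so [mu - nu] ought to be the sum over
    [s > r] of [b_s] times the [s]-fold difference of the Poisson law of
    parameter [lambda].  That law is the [s]-th convolution power of the Poisson
    law of parameter [lambda / s], and one difference of a Poisson law of
    parameter [m] has l1 norm at most [m^{-1/2}] (its standard deviation divided
    by [m]).  Since the l1 norm is submultiplicative under convolution, the
    [s]-th term has norm at most [|b_s| (s / lambda)^{s/2}], and the hypothesis
    on [b_s] is exactly what turns this into [(tau / sqrt lambda)^s]: a geometric
    series, whose sum is of the order of its first term.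

    The argument below replaces every Poisson law by a binomial one, so that the
    signed measures become polynomials in [X = e^{ix}], convolution becomes
    multiplication, and no infinite convolution is ever formed.
    - [l1norm_diff_binomial] is the bound on one difference.  It rests on the
      identity [diff_binomial_pgf], which writes the difference as the centred
      binomial variable times the binomial weights, and on the variance.
      Submultiplicativity ([l1normM]) then gives [l1norm_iterated_diff_binomial].
    - [cexp_binomial_approx] compares [e^{lambda z}] with
      [(1 + lambda z / N)^N], uniformly on the circle, with an error [O(1/N)].
    - [normr_fourier_coef_le] inverts the Fourier transform: an absolutely
      summable sequence is bounded by the supremum of its Fourier series.  For
      polynomials this is the average over roots of unity.
    - [comparison_poly] is the resulting polynomial stand-in for [mu - nu].  Its
      l1 norm is bounded by [l1norm_comparison_poly]; its values on the circle
      are as close as desired to the transform of [mu - nu]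
      ([comparison_poly_approx]), hence so are its coefficients to the atoms of
      [mu - nu], which gives [l1_le_of_fourier].
    The binomial laws lose at most a factor [2] per difference against the
    Poisson ones, so the [s]-th term is at most [(2 tau / sqrt lambda)^s].  With
    [D = 4] the ratio of the series is then below [1/2], and [C = 1] works. *)

Set Implicit Arguments.
Unset Strict Implicit.
Unset Printing Implicit Defensive.

Import Order.TTheory GRing.Theory Num.Theory.
Import numFieldNormedType.Exports.

Local Open Scope classical_set_scope.
Local Open Scope ring_scope.
Local Open Scope complex_scope.

(** * The l1 norm of polynomials *)

Section L1Norm.
Variable F : numDomainType.
Implicit Types p q : {poly F}.

Definition l1norm p : F := \sum_(i < size p) `|p`_i|.

Lemma l1norm_ge0 p : 0 <= l1norm p.
Proof. by apply: sumr_ge0 => i _; apply: normr_ge0. Qed.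

Lemma l1normE n p : (size p <= n)%N -> l1norm p = \sum_(i < n) `|p`_i|.
Proof.
move=> pn; rewrite /l1norm (big_ord_widen n (fun i => `|p`_i|)) //.
rewrite big_mkcond; apply: eq_bigr => i _.
by case: ltnP => // /(nth_default 0) ->; rewrite normr0.
Qed.

Lemma sum_normr_coef_le n p : \sum_(i < n) `|p`_i| <= l1norm p.
Proof.
rewrite (@l1normE (maxn n (size p))) ?leq_maxr //.
rewrite (big_ord_widen _ (fun i => `|p`_i|) (leq_maxl n (size p))).
by rewrite big_mkcond; apply: ler_sum => i _; case: ifP.
Qed.

Lemma l1normD p q : l1norm (p + q) <= l1norm p + l1norm q.
Proof.
pose n := maxn (size p) (size q).
rewrite (@l1normE n (p + q)); last by rewrite (leq_trans (size_polyD _ _)).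
rewrite (@l1normE n p) ?leq_maxl // (@l1normE n q) ?leq_maxr // -big_split /=.
by apply: ler_sum => i _; rewrite coefD ler_normD.
Qed.

Lemma l1norm0 : l1norm 0 = 0.
Proof. by rewrite /l1norm size_poly0 big_ord0. Qed.

Lemma l1norm1 : l1norm 1 = 1.
Proof. by rewrite /l1norm size_poly1 big_ord1 coef1 normr1. Qed.

Lemma l1norm_sum (I : Type) (r : seq I) (P : pred I) (f : I -> {poly F}) :
  l1norm (\sum_(i <- r | P i) f i) <= \sum_(i <- r | P i) l1norm (f i).
Proof.
elim/big_ind2: _ => [|x1 x2 y1 y2 le1 le2|//]; first by rewrite l1norm0.
by rewrite (le_trans (l1normD _ _)) ?lerD.
Qed.

Lemma l1normZ a p : l1norm (a *: p) = `|a| * l1norm p.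
Proof.
rewrite (@l1normE (size p)) ?size_scale_leq // mulr_sumr.
by apply: eq_bigr => i _; rewrite coefZ normrM.
Qed.

(** Replacing every coefficient by its modulus turns [l1norm] into evaluation
    at [1], which is multiplicative; the modulus of a coefficient of [p * q] is at
    most the corresponding coefficient of the product of the two images. *)
Lemma l1normM p q : l1norm (p * q) <= l1norm p * l1norm q.
Proof.
pose N (r : {poly F}) := \poly_(i < size r) `|r`_i|.
have NE r : (N r).[1] = l1norm r.
  rewrite (@horner_coef_wide _ (size r)) ?size_poly //.
  by apply: eq_bigr => i _; rewrite expr1n mulr1 coef_poly ltn_ord.
have Nc r i : (N r)`_i = `|r`_i|.
  by rewrite coef_poly; case: ltnP => // /(nth_default 0) ->; rewrite normr0.
rewrite -!NE -hornerM NE.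
rewrite (@horner_coef_wide _ (maxn (size (p * q)) (size (N p * N q)))) ?leq_maxr //.
rewrite (@l1normE (maxn (size (p * q)) (size (N p * N q)))) ?leq_maxl //.
apply: ler_sum => i _; rewrite expr1n mulr1 !coefM.
rewrite (le_trans (ler_norm_sum _ _ _)) //.
by apply: ler_sum => j _; rewrite !Nc normrM.
Qed.

Lemma l1norm_expr p s : l1norm (p ^+ s) <= l1norm p ^+ s.
Proof.
elim: s => [|s IH]; first by rewrite !expr0 l1norm1.
rewrite !exprS (le_trans (l1normM _ _)) // ler_wpM2l //.
exact: l1norm_ge0.
Qed.
End L1Norm.

(** * Differences of binomial laws *)

Section Binomial.
Variable F : numFieldType.
Implicit Types p q t a : F.

(** For [q + p = 1], the generating function of the binomial law with [n]
    trials and success probability [p]. *)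
Definition binomial_pgf q p n : {poly F} := (q%:P + p *: 'X) ^+ n.

Lemma size_binomial_pgf q p n : (size (binomial_pgf q p n) <= n.+1)%N.
Proof.
have s2 : (size (q%:P + p *: 'X)%R <= 2)%N.
  rewrite (leq_trans (size_polyD _ _)) // geq_max.
  rewrite (leq_trans (size_polyC_leq1 _)) //=.
  by rewrite (leq_trans (size_scale_leq _ _)) // size_polyX.
rewrite (leq_trans (size_poly_exp_leq _ _)) // ltnS -{2}[n]mul1n leq_mul2r.
by apply/orP; right; move: s2; case: (size _).
Qed.

Lemma binomial_pgf_coefS q p n i :
  (binomial_pgf q p n.+1)`_i =
    q * (binomial_pgf q p n)`_i +
    (if i is j.+1 then p * (binomial_pgf q p n)`_j else 0).
Proof.
rewrite /binomial_pgf exprS mulrDl coefD coefCM -scalerAl coefZ coefXM.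
by case: i => //=; rewrite mulr0.
Qed.

Lemma binomial_pgf_coef_ge0 q p n i : 0 <= q -> 0 <= p ->
  0 <= (binomial_pgf q p n)`_i.
Proof.
move=> q0 p0; elim: n i => [|n IH] i.
  by rewrite /binomial_pgf expr0 coef1 ler0n.
rewrite binomial_pgf_coefS addr_ge0 ?mulr_ge0 //.
by case: i => // i; rewrite mulr_ge0.
Qed.

Lemma binomial_total q p n : q + p = 1 ->
  \sum_(i < n.+1) (binomial_pgf q p n)`_i = 1.
Proof.
move=> qp; have := horner_coef_wide 1 (size_binomial_pgf q p n).
rewrite /binomial_pgf horner_exp !hornerE qp expr1n => ->.
by apply: eq_bigr => i _; rewrite expr1n mulr1.
Qed.

(** The centre [a] is arbitrary because conditioning on the first trial, which
    drives the induction, moves it to [a - 1]. *)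
Lemma binomial_variance_around q p n a : q + p = 1 ->
  \sum_(i < n.+1) (binomial_pgf q p n)`_i * (i%:R - a) ^+ 2 =
  n%:R * p * q + (n%:R * p - a) ^+ 2.
Proof.
move=> qp; elim: n a => [|n IH] a.
  by rewrite big_ord1 /binomial_pgf expr0 coef1 /=; ring.
have -> : \sum_(i < n.+2) (binomial_pgf q p n.+1)`_i * (i%:R - a) ^+ 2 =
    q * (\sum_(i < n.+1) (binomial_pgf q p n)`_i * (i%:R - a) ^+ 2) +
    p * (\sum_(i < n.+1) (binomial_pgf q p n)`_i * (i%:R - (a - 1)) ^+ 2).
  under eq_bigr do rewrite binomial_pgf_coefS mulrDl.
  rewrite big_split /=; congr (_ + _).
    rewrite big_ord_recr /= nth_default ?size_binomial_pgf //.
    rewrite mulr0 mul0r addr0 mulr_sumr.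
    by apply: eq_bigr => i _; rewrite -mulrA.
  rewrite big_ord_recl /= mul0r add0r mulr_sumr.
  apply: eq_bigr => i _; rewrite /bump leq0n add1n -natr1 -mulrA; do 2 congr (_ * _).
  by congr (_ ^+ 2); ring.
rewrite !IH -[n.+1%:R]natr1.
have -> : q = 1 - p by rewrite -qp addrK.
by ring.
Qed.

(** On coefficients: up to the factor [(n+1)pq], the difference of the binomial
    weights of [n] trials at [i] is [i - (n+1)p] times the weight of [n+1] trials
    at [i], because ['X * B^`()] has coefficients [i * B`_i]. *)
Lemma diff_binomial_pgf q p n : q + p = 1 ->
  (n.+1%:R * p * q) *: (('X - 1) * binomial_pgf q p n) =
  'X * (binomial_pgf q p n.+1)^`() - (n.+1%:R * p) *: binomial_pgf q p n.+1.
Proof.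
move=> qp; rewrite /binomial_pgf deriv_exp derivD derivC derivZ derivX add0r /=.
rewrite exprS; set Q := (_ ^+ n).
rewrite -!mul_polyC !polyCM polyC_natr -mulr_natl.
have -> : q%:P = 1 - p%:P :> {poly F} by rewrite -polyC1 -polyCB -qp addrK.
by ring.
Qed.

(** By [diff_binomial_pgf] the norm is the mean absolute deviation of the
    binomial law divided by its variance [t ^+ 2], and the mean absolute
    deviation is at most the standard deviation [t]. *)
Lemma l1norm_diff_binomial q p n t : q + p = 1 -> 0 < p -> 0 < q -> 0 < t ->
  t ^+ 2 = n.+1%:R * p * q -> l1norm (('X - 1) * binomial_pgf q p n) <= t^-1.
Proof.
move=> qp p0 q0 t0 tE; set B := binomial_pgf q p n.+1.
have t20 : 0 < t ^+ 2 by rewrite exprn_gt0.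
suff : t ^+ 2 * l1norm (('X - 1) * binomial_pgf q p n) <= t.
  by rewrite -ler_pdivlMl // expr2 invfM -mulrA mulVf ?mulr1 // gt_eqF.
rewrite -[t ^+ 2]gtr0_norm // -l1normZ {1}tE diff_binomial_pgf //.
have sB : (size ('X * B^`() - (n.+1%:R * p) *: B)%R <= n.+2)%N.
  have sB0 := size_binomial_pgf q p n.+1.
  rewrite (leq_trans (size_polyD _ _)) // geq_max size_polyN.
  rewrite (leq_trans (size_scale_leq _ _)) // andbT.
  have [->|nz] := eqVneq (B^`()) 0; first by rewrite mulr0 size_poly0.
  rewrite -commr_polyX size_mulX //.
  rewrite (leq_trans (lt_size_deriv _)) //.
  by apply: contraNneq nz => ->; rewrite deriv0.
rewrite (l1normE sB).
(* Termwise, [|x| <= (t + x ^+ 2 / t) / 2]; the right-hand sides sum to [t]. *)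
have -> : t = \sum_(i < n.+2) (2^-1 * (t * B`_i) +
    2^-1 * (t^-1 * (B`_i * (i%:R - n.+1%:R * p) ^+ 2))).
  rewrite big_split /= -!mulr_sumr binomial_total //.
  rewrite binomial_variance_around // subrr -tE expr0n addr0.
  by field; rewrite gt_eqF.
apply: ler_sum => i _.
have B0 : 0 <= B`_i by rewrite binomial_pgf_coef_ge0 ?ltW.
rewrite coefB coefZ coefXM.
have -> : (if i == 0%N :> nat then 0 else (B^`())`_i.-1) = i%:R * B`_i.
  by case: i B0 => -[|i] /= _ _; rewrite ?mul0r // coef_deriv mulr_natl.
rewrite -mulrBl normrM (ger0_norm B0).
set x := (i%:R - _); have xr : x \is Num.real.
  by rewrite rpredB ?realn // rpredM ?realn // gtr0_real.
rewrite -subr_ge0 -(real_normK xr).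
have -> : 2^-1 * (t * B`_i) + 2^-1 * (t^-1 * (B`_i * `|x| ^+ 2)) - `|x| * B`_i =
          B`_i * (2^-1 * t^-1) * (t - `|x|) ^+ 2.
  by field; rewrite gt_eqF.
apply: mulr_ge0; first by rewrite !mulr_ge0 // invr_ge0 ?ler0n ?(ltW t0).
by rewrite real_exprn_even_ge0 // rpredB // ?(gtr0_real t0) // ger0_real.
Qed.

(** [n * s] trials are shared out evenly among the [s] differences. *)
Lemma l1norm_iterated_diff_binomial q p n s t :
  q + p = 1 -> 0 < p -> 0 < q -> 0 < t -> t ^+ 2 = n.+1%:R * p * q ->
  l1norm (('X - 1) ^+ s * binomial_pgf q p (n * s)) <= t^-1 ^+ s.
Proof.
move=> qp p0 q0 t0 tE; rewrite /binomial_pgf exprM -exprMn.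
rewrite (le_trans (l1norm_expr _ _)) // lerXn2r ?nnegrE ?l1norm_ge0 //.
  by rewrite invr_ge0 ltW.
exact: l1norm_diff_binomial.
Qed.
End Binomial.

(** * The complex exponential *)

Lemma ler_norm_subrX (F : numDomainType) (a b : F) n :
  `|a| <= 1 -> `|b| <= 1 -> `|a ^+ n - b ^+ n| <= n%:R * `|a - b|.
Proof.
move=> a1 b1; elim: n => [|n IH]; first by rewrite !expr0 subrr normr0 mul0r.
have -> : a ^+ n.+1 - b ^+ n.+1 = a * (a ^+ n - b ^+ n) + (a - b) * b ^+ n.
  by rewrite !exprS; ring.
rewrite -natr1 [leRHS]mulrDl mul1r (le_trans (ler_normD _ _)) // !normrM lerD //.
  by rewrite (le_trans _ IH) // ler_piMl.
by rewrite normrX ler_piMr // exprn_ile1.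
Qed.

Section ComplexExponential.
Variable R : realType.
Implicit Types (x y : R) (u v : R[i]).

Lemma normr_real_complex x : `|x%:C| = `|x|%:C.
Proof. by rewrite normc_def /= expr0n addr0 sqrtr_sqr. Qed.

Lemma normr_complex_le x y : `|x +i* y| <= (`|x| + `|y|)%:C.
Proof.
rewrite [x +i* y]complexE /= (le_trans (ler_normD _ _)) // normrM.
have -> : `|'i%C : R[i]| = 1 by rewrite normc_def /= expr0n expr1n add0r sqrtr1.
by rewrite mul1r !normr_real_complex rmorphD.
Qed.

Lemma cexpD u v : cexp (u + v) = cexp u * cexp v.
Proof.
case: u v => [a b] [c d]; rewrite /cexp /= expRD cosD sinD.
by apply/eqP; rewrite eq_complex /=; apply/andP; split; apply/eqP; ring.
Qed.

Lemma cexp0 : cexp 0 = 1 :> R[i].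
Proof.
rewrite /cexp /= expR0 cos0 sin0; apply/eqP; rewrite eq_complex /=.
by apply/andP; split; apply/eqP; ring.
Qed.

Lemma cexpNK u : cexp (- u) * cexp u = 1.
Proof. by rewrite -cexpD addNr cexp0. Qed.

Lemma cexp_natl n u : cexp (n%:R * u) = cexp u ^+ n.
Proof.
elim: n => [|n IH]; first by rewrite mul0r cexp0.
by rewrite -natr1 mulrDl mul1r cexpD IH exprSr.
Qed.

Lemma normr_cexp u : `|cexp u| = (expR (complex.Re u))%:C.
Proof.
rewrite /cexp normrM normr_real_complex [`|expR _|]ger0_norm ?expR_ge0 //.
by rewrite normc_def /= cos2Dsin2 sqrtr1 mulr1.
Qed.

Lemma normr_cexp_le1 u : complex.Re u <= 0 -> `|cexp u| <= 1.
Proof. by move=> u0; rewrite normr_cexp -[leRHS]/(1%:C) lecR expR_le1. Qed.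

Lemma expiE x : expi x = cos x +i* sin x.
Proof. by rewrite /expi /cexp /= expR0 -[1%:C]/(1 : R[i]) mul1r. Qed.

Lemma expi_natl n x : expi (n%:R * x) = expi x ^+ n.
Proof.
rewrite /expi -cexp_natl -(rmorph_nat (real_complex R)); congr cexp.
by apply/eqP; rewrite eq_complex /= !mulr0 !mul0r subr0 addr0 !eqxx.
Qed.

Lemma normr_expi x : `|expi x| = 1.
Proof. by rewrite /expi normr_cexp expR0. Qed.

Lemma normr_expiB1_le x : `|expi x - 1| <= 2.
Proof. by rewrite (le_trans (ler_normB _ _)) // normr_expi normr1. Qed.

Lemma Re_expiB1_le0 x : complex.Re (expi x - 1) <= 0.
Proof. by rewrite expiE /= subr_le0 cos_le1. Qed.

(** The value is the mean of [e^{ixY}] for a Bernoulli variable [Y]. *)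
Lemma normr_bernoulli_expi_le1 (p : R) x : 0 <= p -> p <= 1 ->
  `|1 + p%:C * (expi x - 1)| <= 1.
Proof.
move=> p0 p1.
have -> : 1 + p%:C * (expi x - 1) = (1 - p)%:C + p%:C * expi x.
  by rewrite rmorphB rmorph1; ring.
rewrite (le_trans (ler_normD _ _)) // normrM normr_expi mulr1 !normr_real_complex.
by rewrite !ger0_norm ?subr_ge0 // -rmorphD subrK.
Qed.

Lemma one_sub_cos x : 1 - cos x = 2 * sin (x / 2) ^+ 2.
Proof.
have -> : cos x = cos (x / 2 + x / 2) by congr cos; lra.
by rewrite cosD; have := cos2Dsin2 (x / 2); lra.
Qed.

Lemma normr_sin_le x : `|sin x| <= `|x|.
Proof.
wlog x0 : x / 0 <= x.
  move=> H; case: (leP 0 x) => [/H //|x0].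
  by rewrite -normrN -sinN -[leRHS]normrN H // oppr_ge0 ltW.
have cs : {within `[0, x], continuous (@sin R)}.
  exact/continuous_subspaceT/continuous_sin.
have [c _] := MVT_segment x0 (fun y _ => is_derive_sin y) cs.
rewrite sin0 !subr0 => ->; rewrite normrM ler_piMl //; exact: cos_max.
Qed.

Lemma normr_sinB_le x : `|sin x - x| <= x ^+ 2.
Proof.
wlog x0 : x / 0 <= x.
  move=> H; case: (leP 0 x) => [/H //|x0].
  by have := H (- x); rewrite sinN sqrrN -opprD normrN; apply; rewrite oppr_ge0 ltW.
pose f y : R := sin y - y.
have df y : is_derive y 1 f (cos y - 1) by rewrite /f; apply: is_deriveB.
have cs : {within `[0, x], continuous f}.
  apply/continuous_subspaceT => y; apply: cvgB; [exact: continuous_sin|exact: cvg_id].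
have [c] := MVT_segment x0 (fun y _ => df y) cs.
rewrite in_itv /= => /andP[c0 cx]; rewrite /f sin0 !subr0 => ->.
rewrite normrM (ger0_norm x0) expr2 ler_wpM2r // distrC one_sub_cos.
rewrite [leLHS]ger0_norm; last by apply: mulr_ge0; rewrite ?sqr_ge0.
have := normr_sin_le (c / 2); have := sin_max (c / 2).
rewrite [`|c / 2|]ger0_norm ?divr_ge0 // -(real_normK (num_real (sin (c / 2)))).
have := normr_ge0 (sin (c / 2)); nra.
Qed.

(** For [u = x + iy], the remainder is made of [e^x - 1 - x], [e^x (1 - cos y)],
    [sin y - y] and [(e^x - 1) sin y], each of which is quadratic in [(x, y)]
    when [x <= 0]. *)
Lemma cexp_second_order u : complex.Re u <= 0 ->
  `|cexp u - 1 - u| <= 2 * `|u| ^+ 2.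
Proof.
case: u => x y /= x0.
rewrite -add_Re2_Im2 /= -[2]/(2%:R) -(rmorph_nat (real_complex R) 2) -rmorphM /=.
have -> : cexp (x +i* y) - 1 - (x +i* y) =
    (expR x * cos y - 1 - x) +i* (expR x * sin y - y).
  rewrite /cexp /=; apply/eqP; rewrite eq_complex /=.
  by apply/andP; split; apply/eqP; ring.
rewrite (le_trans (normr_complex_le _ _)) // lecR.
have ex0 : 0 < expR x := expR_gt0 x.
have ex1 : expR x <= 1 by rewrite expR_le1.
have el : 1 + x <= expR x := expR_ge1Dx x.
have eu : expR x <= 1 + x + x ^+ 2.
  have := expR_ge1Dx (- x); rewrite expRN => h.
  have : (1 - x) * expR x <= 1.
    rewrite -[leRHS](mulVf (lt0r_neq0 ex0)) ler_wpM2r ?(ltW ex0) //.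
  by nra.
have c0 : 0 <= 1 - cos y by rewrite subr_ge0 cos_le1.
have cu : 1 - cos y <= y ^+ 2 / 2.
  rewrite one_sub_cos; have := normr_sin_le (y / 2).
  rewrite -(ler_sqr (normr_ge0 _) (normr_ge0 _)) !real_normK ?num_real //.
  by lra.
have h1 : `|expR x * cos y - 1 - x| <= x ^+ 2 + y ^+ 2 / 2.
  by rewrite ler_norml; apply/andP; split; nra.
have h2 : `|expR x * sin y - y| <= `|x| * `|y| + y ^+ 2.
  have -> : expR x * sin y - y = (expR x - 1) * sin y + (sin y - y) by ring.
  rewrite (le_trans (ler_normD _ _)) // lerD ?normr_sinB_le // normrM.
  rewrite ler_pM ?normr_sin_le // (ler0_norm x0) ler0_norm; lra.
have h3 : `|x| * `|y| <= x ^+ 2 / 2 + y ^+ 2 / 2.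
  rewrite -(real_normK (num_real x)) -(real_normK (num_real y)).
  by have := sqr_ge0 (`|x| - `|y|); lra.
have := sqr_ge0 x; have := sqr_ge0 y; lra.
Qed.

(** Both [N]-th powers have a base in the unit disc, so their distance is at
    most [N] times the distance of the bases, which is of second order in
    [lambda / N]. *)
Lemma cexp_binomial_approx (lambda : R) N x :
  0 <= lambda -> lambda <= N%:R -> (0 < N)%N ->
  `|cexp (lambda%:C * (expi x - 1)) -
      (1 + (lambda / N%:R)%:C * (expi x - 1)) ^+ N| <= (8 * lambda ^+ 2 / N%:R)%:C.
Proof.
move=> l0 lN N0; set u := (lambda / N%:R)%:C * _.
have N0' : 0 < N%:R :> R by rewrite ltr0n.
have p0 : 0 <= lambda / N%:R by rewrite divr_ge0.
have p1 : lambda / N%:R <= 1 by rewrite ler_pdivrMr // mul1r.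
have ->: lambda%:C * (expi x - 1) = N%:R * u.
  rewrite /u mulrA -(rmorph_nat (real_complex R) N) -rmorphM /=.
  by congr (_%:C * _); field; rewrite gt_eqF.
have u0 : complex.Re u <= 0.
  rewrite /u; have := Re_expiB1_le0 x; case: (expi x - 1) => a b /= a0.
  by rewrite mul0r subr0 mulr_ge0_le0.
rewrite cexp_natl (le_trans (ler_norm_subrX _ _ _)) //.
- exact: normr_cexp_le1.
- exact: normr_bernoulli_expi_le1.
have -> : (8 * lambda ^+ 2 / N%:R)%:C = N%:R * (2 * ((lambda / N%:R)%:C * 2) ^+ 2).
  rewrite -(rmorph_nat (real_complex R) N) -(rmorph_nat (real_complex R) 2).
  rewrite -!(rmorphM,rmorphXn) /=; congr (_%:C).
  by field; rewrite gt_eqF.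
rewrite ler_wpM2l ?ler0n // opprD addrA (le_trans (cexp_second_order u0)) //.
rewrite ler_wpM2l ?ler0n // lerXn2r ?nnegrE //.
  by rewrite mulr_ge0 ?ler0n // ler0c.
rewrite /u normrM normr_real_complex [`|_ / _|]ger0_norm // ler_wpM2l ?ler0c //.
exact: normr_expiB1_le.
Qed.

(** * Coefficients and values on the unit circle *)

Lemma expi_neq1 x : 0 < x -> x < pi *+ 2 -> expi x != 1.
Proof.
move=> x0 x2; rewrite expiE eq_complex /= negb_and; apply/orP; left.
rewrite eq_sym -subr_eq0 one_sub_cos mulf_neq0 ?pnatr_eq0 // expf_neq0 //.
rewrite gt_eqF // sin_gt0_pi // divr_gt0 //=.
by move: x2; rewrite mulr2n; lra.
Qed.

(** Averaging [p], weighted by a suitable power of the variable, over the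
    [N]-th roots of unity isolates one coefficient as soon as [size p <= N]. *)
Lemma normr_coef_le_circle (p : {poly R[i]}) (M : R[i]) m :
  (forall x, `|p.[expi x]| <= M) -> `|p`_m| <= M.
Proof.
move=> pM; have M0 : 0 <= M := le_trans (normr_ge0 _) (pM 0).
case: (ltnP m (size p)) => [mN|/(nth_default 0) ->]; last by rewrite normr0.
set N := size p in mN *.
have N0 : (0 < N)%N by case: (N) mN.
have N0' : 0 < N%:R :> R by rewrite ltr0n.
pose w := expi (pi *+ 2 / N%:R : R).
have wN : w ^+ N = 1.
  rewrite /w -expi_natl mulrCA divff ?gt_eqF // mulr1 expiE cos2pi sin2pi.
  by apply/eqP; rewrite eq_complex /= !eqxx.
have pi0 : 0 < (pi : R) *+ 2 by rewrite mulrn_wgt0 ?pi_gt0.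
have wd d : (0 < d)%N -> (d < N)%N -> w ^+ d != 1.
  move=> d0 dN; rewrite /w -expi_natl expi_neq1 //.
    by rewrite mulr_gt0 ?ltr0n // divr_gt0.
  by rewrite mulrCA gtr_pMr // ltr_pdivrMr // mul1r ltr_nat.
(* The exponent [k + (N - m)] stands for [k - m] modulo [N]. *)
have wk (k : 'I_N) :
    \sum_(j < N) (w ^+ (k + (N - m))) ^+ j = (if k == m :> nat then N%:R else 0).
  case: eqP => [->|/eqP km].
    rewrite subnKC 1?ltnW // wN; under eq_bigr do rewrite expr1n.
    by rewrite sumr_const card_ord.
  have : w ^+ (k + (N - m)) != 1.
    have kN : (k < N)%N := ltn_ord k.
    case: (ltngtP k m) km => // km _; first by apply: wd; lia.
    have -> : (k + (N - m) = N + (k - m))%N by lia.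
    by rewrite exprD wN mul1r wd //; lia.
  rewrite -subr_eq0 => /mulfI; apply.
  by rewrite -subrX1 -exprM mulnC exprM wN expr1n subrr mulr0.
have avg : \sum_(j < N) (w ^+ j) ^+ (N - m) * p.[w ^+ j] = p`_m * N%:R.
  under eq_bigr => j _ do rewrite horner_coef mulr_sumr.
  rewrite exchange_big /=.
  transitivity (\sum_(k < N) p`_k * (if k == m :> nat then N%:R else 0)).
    apply: eq_bigr => k _; rewrite -wk mulr_sumr; apply: eq_bigr => j _.
    by rewrite mulrCA -exprD -!exprM mulnC [(N - m + k)%N]addnC.
  rewrite (bigD1 (Ordinal mN)) //= eqxx big1 ?addr0 // => k.
  by rewrite -val_eqE /= => /negbTE ->; rewrite mulr0.
have NC : 0 < N%:R :> R[i] by rewrite ltr0n.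
rewrite -(ler_pM2r NC) -{1}[N%:R]ger0_norm ?ler0n // -normrM -avg.
rewrite (le_trans (ler_norm_sum _ _ _)) //.
have -> : M * N%:R = \sum_(j < N) M by rewrite sumr_const card_ord mulr_natr.
apply: ler_sum => j _; rewrite normrM !normrX /w normr_expi !expr1n mul1r.
by rewrite -expi_natl.
Qed.
End ComplexExponential.

Section FourierSeries.
Variable R : realType.

Lemma Re_normrE (z : R[i]) : (complex.Re `|z|)%:C = `|z|.
Proof. by rewrite RRe_real // normr_real. Qed.

Lemma Re_normr_ge0 (z : R[i]) : 0 <= complex.Re `|z|.
Proof. by rewrite -ler0c Re_normrE. Qed.

Lemma cvg_complex_distP (u : nat -> R[i]) (l : R[i]) :
  ((u : nat -> R[i]^o) @ \oo --> (l : R[i]^o)) ->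
  forall e : R, 0 < e -> forall n0, exists2 n, (n0 <= n)%N & `|u n - l| <= e%:C.
Proof.
move=> /cvgrPdist_le ul e e0 n0.
have eC : 0 < e%:C by rewrite -[0]/(0%:C) ltcR.
have [n1 _ H] := ul _ eC.
exists (maxn n0 n1); first exact: leq_maxl.
by rewrite distrC; apply: H => /=; exact: leq_maxr.
Qed.

Lemma summable_tail_le (u : nat -> R) (A e : R) : (forall k, 0 <= u k) ->
  (forall n, \sum_(0 <= k < n) u k <= A) -> 0 < e ->
  exists n0, forall n m, (n0 <= n)%N -> (n <= m)%N -> \sum_(n <= k < m) u k <= e.
Proof.
move=> u0 uA e0.
have nd : nondecreasing_seq (fun n => \sum_(0 <= k < n) u k).
  move=> n m nm; rewrite (big_cat_nat _ nm) //= lerDl.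
  by apply: sumr_ge0.
have cv : cvgn (fun n => \sum_(0 <= k < n) u k).
  apply: nondecreasing_is_cvgn => //; exists A => _ [n _ <-]; exact: uA.
have le := nondecreasing_cvgn_le nd cv.
move/cvgrPdist_le : (cv) => /(_ e e0)[n0 _ H].
exists n0 => n m n0n nm.
have := H n n0n; rewrite /= ger0_norm ?subr_ge0 ?le // => H1.
have := le m; rewrite (big_cat_nat _ nm) //=; lra.
Qed.

(** Truncating where the remaining mass is at most [e / 2] gives a polynomial
    which is at most [M + e] on the circle, so that [normr_coef_le_circle]
    applies. *)
Lemma normr_fourier_coef_le (d : nat -> R[i]) (A M : R) :
  (forall n, \sum_(0 <= k < n) `|d k| <= A%:C) ->
  (forall x, exists2 l : R[i], `|l| <= M%:C &
     ((fun n => \sum_(0 <= k < n) d k * expi (k%:R * x)) : nat -> R[i]^o) @ \oo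
       --> (l : R[i]^o)) ->
  forall m, `|d m| <= M%:C.
Proof.
move=> dA dM m.
rewrite -Re_normrE lecR; apply/ler_addgt0Pr => e e0.
have e20 : 0 < e / 2 by rewrite divr_gt0.
have uA n : \sum_(0 <= k < n) complex.Re `|d k| <= A.
  rewrite -lecR rmorph_sum /=; under eq_bigr do rewrite Re_normrE.
  exact: dA.
have [n0 tail] := summable_tail_le (fun k => Re_normr_ge0 (d k)) uA e20.
pose N := maxn n0 m.+1.
have mN : (m < N)%N by rewrite leq_maxr.
pose p := \poly_(k < N) d k.
have -> : d m = p`_m by rewrite coef_poly mN.
rewrite -lecR Re_normrE; apply: normr_coef_le_circle => x.
have [l lM dl] := dM x.
have [n Nn nl] := cvg_complex_distP dl e20 N.
have -> : p.[expi x] = l + (\sum_(0 <= k < n) d k * expi (k%:R * x) - l)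
    - \sum_(N <= k < n) d k * expi (k%:R * x).
  rewrite (big_cat_nat _ Nn) //= horner_poly big_mkord.
  rewrite (eq_bigr (fun k : 'I_N => d k * expi (k%:R * x))); last first.
    by move=> k _; rewrite expi_natl.
  by ring.
have -> : (M + e)%:C = M%:C + (e / 2)%:C + (e / 2)%:C.
  by rewrite -!rmorphD /=; congr (_%:C); lra.
rewrite (le_trans (ler_normB _ _)) // lerD //.
  by rewrite (le_trans (ler_normD _ _)) // lerD.
rewrite (le_trans (ler_norm_sum _ _ _)) //.
under eq_bigr do rewrite normrM normr_expi mulr1 -Re_normrE.
by rewrite -rmorph_sum /= lecR tail // leq_maxl.
Qed.

Lemma cvg_poly_fourier (p : {poly R[i]}) x :
  ((fun n => \sum_(0 <= k < n) p`_k * expi (k%:R * x)) : nat -> R[i]^o) @ \oo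
    --> (p.[expi x] : R[i]^o).
Proof.
apply: cvg_near_cst; exists (size p) => // n /= pn.
rewrite (horner_coef_wide _ pn) big_mkord.
by apply: eq_bigr => k _; rewrite expi_natl.
Qed.

Lemma geometric_tail_le (x : R) m n : 0 <= x -> x <= 2^-1 ->
  \sum_(m <= s < n) x ^+ s <= 2 * x ^+ m.
Proof.
move=> x0 x2; case: (leqP m n) => [mn|nm]; last first.
  by rewrite big_geq 1?ltnW // mulr_ge0 // exprn_ge0.
suff : \sum_(m <= s < n) x ^+ s <= 2 * x ^+ m - 2 * x ^+ n.
  by have := exprn_ge0 n x0; lra.
elim: n mn => [|n IH]; first by rewrite leqn0 => /eqP ->; rewrite big_geq // subrr.
rewrite leq_eqVlt => /predU1P[->|mn]; first by rewrite big_geq // subrr.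
rewrite big_nat_recr //= exprS; have := IH mn; have := exprn_ge0 n x0; nra.
Qed.
End FourierSeries.

(** * Polynomials approximating the residual measure *)

Section Comparison.
Variables (R : realType) (lambda tau : R) (b : nat -> R[i]).
Hypotheses (lambda_gt0 : 0 < lambda) (tau_gt0 : 0 < tau).
Hypothesis b_le : forall s : nat, (2 <= s)%N ->
  `|b s| <= ((tau / Num.sqrt (s%:R)) ^+ s)%:C.

Lemma expansion_term_le x s : (2 <= s)%N -> 16 * tau ^+ 2 <= s%:R ->
  `|b s * (expi x - 1) ^+ s| <= (2^-1 ^+ s)%:C.
Proof.
move=> s2 st; have s0 : 0 < s%:R :> R by rewrite ltr0n; lia.
have z2 := lerXn2r s _ _ (normr_expiB1_le x).
rewrite normrM normrX (le_trans (ler_pM _ _ (b_le s2) (z2 _ _)))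
  ?exprn_ge0 ?nnegrE ?ler0n //.
rewrite -(rmorph_nat (real_complex R) 2) -rmorphXn -rmorphM /= lecR -exprMn.
have q0 : 0 < Num.sqrt s%:R :> R by rewrite sqrtr_gt0.
rewrite lerXn2r ?nnegrE ?invr_ge0 // ?mulr_ge0 ?divr_ge0 // ?(ltW tau_gt0) ?(ltW q0) //.
rewrite mulrAC ler_pdivrMr //.
suff : 4 * tau <= Num.sqrt s%:R by lra.
rewrite -(ler_sqr (x := 4 * tau)) ?nnegrE ?sqr_sqrtr ?sqrtr_ge0 ?mulr_ge0
  ?(ltW s0) ?(ltW tau_gt0) //.
by have -> : (4 * tau) ^+ 2 = 16 * tau ^+ 2 by ring.
Qed.

(** Pointwise convergence on the circle is uniform: beyond [s = 16 tau^2] the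
    terms are at most [2^{-s}], as [expansion_term_le] shows. *)
Lemma expansion_uniform_tail (L : R -> R[i]) (e : R) : 0 < e ->
  (forall x, ((fun n : nat => 1 + \sum_(2 <= s < n) b s * (expi x - 1) ^+ s)
      : nat -> R[i]^o) @ \oo --> (L x : R[i]^o)) ->
  exists n0, forall n, (n0 <= n)%N -> forall x,
    `|L x - (1 + \sum_(2 <= s < n) b s * (expi x - 1) ^+ s)| <= e%:C.
Proof.
move=> e0 cvL.
pose n0 := maxn 2 (maxn (Num.truncn (16 * tau ^+ 2)).+1 (Num.truncn (4 / e)).+1).
exists n0 => n n0n x.
have n2 : (2 <= n)%N by rewrite (leq_trans _ n0n) // leq_maxl.
have nt : 16 * tau ^+ 2 <= n%:R.
  rewrite (le_trans (ltW (truncnS_gt _))) // ler_nat (leq_trans _ n0n) //.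
  by rewrite !leq_max leqnn orbT.
have ne : 4 / e <= n%:R.
  rewrite (le_trans (ltW (truncnS_gt _))) // ler_nat (leq_trans _ n0n) //.
  by rewrite !leq_max leqnn !orbT.
have e20 : 0 < e / 2 by rewrite divr_gt0.
have [m nm Hm] := cvg_complex_distP (cvL x) e20 n.
have -> : L x - (1 + \sum_(2 <= s < n) b s * (expi x - 1) ^+ s) =
  - (1 + \sum_(2 <= s < m) b s * (expi x - 1) ^+ s - L x) +
  \sum_(n <= s < m) b s * (expi x - 1) ^+ s.
  by rewrite (big_cat_nat _ nm) //=; ring.
have -> : e%:C = (e / 2)%:C + (e / 2)%:C by rewrite -rmorphD /=; congr (_%:C); lra.
rewrite (le_trans (ler_normD _ _)) // normrN lerD //.
rewrite (le_trans (ler_norm_sum _ _ _)) //.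
apply: (@le_trans _ _ (\sum_(n <= s < m) (2^-1 ^+ s))%:C).
  rewrite rmorph_sum /=; apply: ler_sum_nat => s /andP[ns sm].
  apply: expansion_term_le; first exact: leq_trans ns.
  by rewrite (le_trans nt) // ler_nat.
rewrite lecR (le_trans (geometric_tail_le _ _ _ _)) ?invr_ge0 //.
have n0' : 0 < n%:R :> R by rewrite ltr0n; lia.
have h : n%:R <= 2 ^+ n :> R by rewrite -natrX ler_nat ltnW // ltn_expl.
have : 2 * 2^-1 ^+ n <= 2 / n%:R :> R.
  by rewrite ler_pM2l // exprVn lef_pV2 ?posrE ?exprn_gt0.
move=> /le_trans; apply.
rewrite ler_pdivrMr //; move: ne; rewrite ler_pdivrMr //; lra.
Qed.

(** The generating function that the expansion suggests for [mu - nu], truncated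
    at [n] and with the Poisson law of parameter [lambda] replaced, in the term of
    index [s], by a binomial law of the same mean.  The number of trials [M * s]
    depends on [s] so that it splits into [s] equal parts. *)
Definition comparison_poly M r n : {poly R[i]} :=
  \sum_(r.+1 <= s < n) b s *: (('X - 1) ^+ s *
    binomial_pgf (1 - lambda / (M * s)%:R)%:C (lambda / (M * s)%:R)%:C (M * s)).

(** The bound [2 * lambda <= M] keeps the success probabilities at most [1/2],
    which costs the factor [2] in front of [tau]. *)
Lemma l1norm_comparison_poly M r n : (1 <= r)%N -> 2 * lambda <= M%:R ->
  4 * tau / Num.sqrt lambda < 1 ->
  l1norm (comparison_poly M r n) <=
    (2 * (2 * tau / Num.sqrt lambda) ^+ r.+1)%:C.
Proof.
move=> r1 Ml eps1; set y := 2 * tau / _.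
have sl0 : 0 < Num.sqrt lambda by rewrite sqrtr_gt0.
have y0 : 0 <= y by rewrite /y divr_ge0 // ?mulr_ge0 // ltW.
have y2 : y <= 2^-1.
  by move: eps1; rewrite /y !ltr_pdivrMr // ler_pdivrMr //; lra.
rewrite (le_trans (l1norm_sum _ _ _)) //.
apply: (@le_trans _ _ (\sum_(r.+1 <= s < n) y ^+ s)%:C); last first.
  by rewrite lecR geometric_tail_le.
rewrite rmorph_sum /=; apply: ler_sum_nat => s /andP[rs _].
have s2 : (2 <= s)%N by lia.
have s0 : 1 <= s%:R :> R by rewrite ler1n; lia.
have s0' : 0 < s%:R :> R by lra.
have M0 : 0 < M%:R :> R by apply: lt_le_trans Ml; rewrite mulr_gt0.
pose p := lambda / (M * s)%:R; rewrite -/p.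
have pE : p * (M%:R * s%:R) = lambda.
  by rewrite /p natrM; field; rewrite !gt_eqF.
have p0 : 0 < p by rewrite /p divr_gt0 // natrM mulr_gt0.
have p1 : p <= 2^-1.
  have : M%:R <= M%:R * s%:R :> R by rewrite ler_peMr // ltW.
  by rewrite /p natrM ler_pdivrMr ?mulr_gt0 //; lra.
clearbody p.
pose t2 := M.+1%:R * p * (1 - p).
have t20 : 0 < t2 by rewrite !mulr_gt0 //; lra.
pose t := Num.sqrt t2.
have t0 : 0 < t by rewrite sqrtr_gt0.
rewrite l1normZ.
apply: (@le_trans _ _ (((tau / Num.sqrt (s%:R)) ^+ s)%:C * (t%:C^-1 ^+ s))).
  apply: ler_pM; rewrite ?normr_ge0 ?l1norm_ge0 ?b_le //.
  apply: l1norm_iterated_diff_binomial.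
  - by rewrite -rmorphD subrK.
  - by rewrite -[0]/(0%:C) ltcR.
  - by rewrite -[0]/(0%:C) ltcR; lra.
  - by rewrite -[0]/(0%:C) ltcR.
  - by rewrite -rmorphXn /= sqr_sqrtr ?ltW // /t2 !rmorphM rmorph_nat.
rewrite -fmorphV -rmorphXn -rmorphM /= lecR -exprMn.
have ss0 : 0 < Num.sqrt s%:R :> R by rewrite sqrtr_gt0.
rewrite lerXn2r ?nnegrE // ?mulr_ge0 ?invr_ge0 // ?(ltW tau_gt0) ?(ltW ss0) ?(ltW t0) //.
rewrite -mulrA -invfM /y ler_pdivrMr ?mulr_gt0 // mulrAC ler_pdivlMr //.
rewrite [2 * tau]mulrC -mulrA ler_pM2l //.
rewrite -ler_sqr ?nnegrE ?mulr_ge0 ?sqrtr_ge0 //.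
rewrite !exprMn !sqr_sqrtr ?(ltW s0') ?(ltW t20) ?(ltW lambda_gt0) //.
rewrite -[in leLHS]pE /t2 -natr1.
have ps0 : 0 <= p * s%:R by rewrite mulr_ge0 // ltW.
have : 0 <= p * s%:R * M%:R by rewrite mulr_ge0.
have : 0 <= p * s%:R * (M%:R + 1) * (1 - 2 * p) by rewrite !mulr_ge0 //; lra.
lra.
Qed.

Lemma horner_comparison_poly M r n x :
  (comparison_poly M r n).[expi x] = \sum_(r.+1 <= s < n)
    b s * (expi x - 1) ^+ s *
    (1 + (lambda / (M * s)%:R)%:C * (expi x - 1)) ^+ (M * s).
Proof.
rewrite horner_sum; apply: eq_bigr => s _.
rewrite hornerZ hornerM !horner_exp hornerD hornerN !hornerD !hornerX hornerZ.
rewrite hornerX !hornerC mulrA; congr (_ * _ ^+ _).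
by rewrite rmorphB rmorph1; ring.
Qed.

(** The degree [n] is chosen first, from the tail of the expansion; the error of
    the finitely many binomial approximations then vanishes as [M] grows. *)
Lemma comparison_poly_approx (L : R -> R[i]) (e : R) r : 0 < e -> (1 <= r)%N ->
  (forall x, ((fun n : nat => 1 + \sum_(2 <= s < n) b s * (expi x - 1) ^+ s)
      : nat -> R[i]^o) @ \oo --> (L x : R[i]^o)) ->
  exists n M, 2 * lambda <= M%:R /\ forall x,
    `|cexp (lambda%:C * (expi x - 1)) *
        (L x - (1 + \sum_(2 <= s < r.+1) b s * (expi x - 1) ^+ s)) -
      (comparison_poly M r n).[expi x]| <= e%:C.
Proof.
move=> e0 r1 cvL.
have e20 : 0 < e / 2 by rewrite divr_gt0.
have [n0 Hn] := expansion_uniform_tail e20 cvL.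
pose n := maxn n0 r.+1.
have nr : (r.+1 <= n)%N by rewrite leq_maxr.
have {}Hn x := Hn n (leq_maxl _ _) x.
(* [B / M] bounds the total error of the binomial approximations. *)
pose B := \sum_(r.+1 <= s < n) complex.Re `|b s| * 2 ^+ s * (8 * lambda ^+ 2).
have B0 : 0 <= B.
  by apply: sumr_ge0 => s _; rewrite !mulr_ge0 ?Re_normr_ge0 ?exprn_ge0 // ltW.
pose M := (Num.truncn (2 * lambda + 2 * B / e)).+1.
have MB : 2 * lambda + 2 * B / e <= M%:R by exact: ltW (truncnS_gt _).
have Be0 : 0 <= 2 * B / e by rewrite divr_ge0 ?mulr_ge0 // ltW.
have M2 : 2 * lambda <= M%:R by lra.
have h : 2 * B / e <= M%:R by have := lambda_gt0; lra.
have M0 : 0 < M%:R :> R by rewrite ltr0n.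
exists n, M; split=> // x.
rewrite horner_comparison_poly; set z := expi x - 1; set w := cexp _.
have -> : w * (L x - (1 + \sum_(2 <= s < r.+1) b s * z ^+ s)) -
    \sum_(r.+1 <= s < n)
      b s * z ^+ s * (1 + (lambda / (M * s)%:R)%:C * z) ^+ (M * s)
  = w * (L x - (1 + \sum_(2 <= s < n) b s * z ^+ s)) +
    \sum_(r.+1 <= s < n) b s * z ^+ s *
      (w - (1 + (lambda / (M * s)%:R)%:C * z) ^+ (M * s)).
  under [X in _ = _ + X]eq_bigr do rewrite mulrBr.
  have r2 : (2 <= r.+1)%N by [].
  rewrite sumrB -mulr_suml (big_cat_nat r2 nr) /=.
  set S1 := \sum_(2 <= s < r.+1) _; set S2 := \sum_(r.+1 <= s < n) b s * z ^+ s.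
  by ring.
have -> : e%:C = (e / 2)%:C + (e / 2)%:C by rewrite -rmorphD /=; congr (_%:C); lra.
rewrite (le_trans (ler_normD _ _)) // lerD //.
  rewrite normrM (le_trans _ (Hn x)) // ler_piMl //.
  rewrite /w normr_cexp_le1 //.
  have := Re_expiB1_le0 x; rewrite -/z; case: (z) => u v /= u0.
  by rewrite mul0r subr0 pmulr_rle0.
rewrite (le_trans (ler_norm_sum _ _ _)) //.
apply: (@le_trans _ _ (\sum_(r.+1 <= s < n)
    complex.Re `|b s| * 2 ^+ s * (8 * lambda ^+ 2) / M%:R)%:C); last first.
  rewrite lecR -mulr_suml -/B ler_pdivrMr //.
  by move: h; rewrite ler_pdivrMr //; lra.
rewrite rmorph_sum /=; apply: ler_sum_nat => s /andP[rs _].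
have s1 : (1 <= s)%N by lia.
have Ms : M%:R <= (M * s)%:R :> R by rewrite ler_nat leq_pmulr.
have -> : (complex.Re `|b s| * 2 ^+ s * (8 * lambda ^+ 2) / M%:R)%:C =
    `|b s| * (2 ^+ s)%:C * (8 * lambda ^+ 2 / M%:R)%:C.
  by rewrite -(Re_normrE (b s)) -mulrA -!rmorphM.
rewrite 2!normrM normrX.
apply: ler_pM; rewrite ?mulr_ge0 ?exprn_ge0 //.
  rewrite ler_wpM2l // rmorphXn rmorph_nat /=.
  by rewrite lerXn2r ?nnegrE ?ler0n ?normr_expiB1_le.
rewrite (le_trans (cexp_binomial_approx _ _ _ _)) ?(ltW lambda_gt0) //.
- by have := lambda_gt0; lra.
- by rewrite muln_gt0 s1.
- rewrite lecR ler_pM2l ?mulr_gt0 ?exprn_gt0 // lef_pV2 ?posrE //.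
  by lra.
Qed.

(** For fixed [K], the first [K] entries of [a] are approximated to any accuracy
    by coefficients of [comparison_poly], whose l1 norm has a bound that does not
    depend on the approximation. *)
Lemma l1_le_of_fourier (a : nat -> R) (A : R) (L : R -> R[i]) r :
  (1 <= r)%N -> 4 * tau / Num.sqrt lambda < 1 ->
  (forall n, \sum_(0 <= k < n) `|a k| <= A) ->
  (forall x, ((fun n : nat => 1 + \sum_(2 <= s < n) b s * (expi x - 1) ^+ s)
      : nat -> R[i]^o) @ \oo --> (L x : R[i]^o)) ->
  (forall x,
    ((fun n : nat => \sum_(0 <= k < n) (a k)%:C * expi (k%:R * x))
      : nat -> R[i]^o) @ \oo -->
    (cexp (lambda%:C * (expi x - 1)) *
      (L x - (1 + \sum_(2 <= s < r.+1) b s * (expi x - 1) ^+ s)) : R[i]^o)) ->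
  forall K, \sum_(0 <= k < K) `|a k| <=
    2 * (2 * tau / Num.sqrt lambda) ^+ r.+1.
Proof.
move=> r1 eps1 aA cvL cva K; apply/ler_addgt0Pr => e e0.
pose h := e / K.+1%:R; have h0 : 0 < h by rewrite divr_gt0.
have [n [M [M2 approx]]] := comparison_poly_approx h0 r1 cvL.
set c := comparison_poly M r n in approx.
have cl := l1norm_comparison_poly n r1 M2 eps1; rewrite -/c in cl.
have sc m : \sum_(0 <= k < m) `|c`_k| <= (complex.Re (l1norm c))%:C.
  rewrite RRe_real ?ger0_real ?l1norm_ge0 // big_mkord; exact: sum_normr_coef_le.
have dh m : `|(a m)%:C - c`_m| <= h%:C.
  apply: (@normr_fourier_coef_le _ (fun m => (a m)%:C - c`_m)
    (A + complex.Re (l1norm c)) h).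
    move=> q; rewrite rmorphD /=.
    apply: (@le_trans _ _ (\sum_(0 <= k < q) (`|a k|%:C + `|c`_k|))).
      apply: ler_sum => k _.
      by rewrite (le_trans (ler_normB _ _)) // normr_real_complex.
    by rewrite big_split lerD ?sc // -rmorph_sum lecR.
  move=> x; eexists; first exact: approx x.
  rewrite [X in X @ _ --> _](_ : _ = (fun n : nat =>
    (\sum_(0 <= k < n) (a k)%:C * expi (k%:R * x) : R[i]^o) -
     \sum_(0 <= k < n) c`_k * expi (k%:R * x))).
    exact: cvgB (cva x) (cvg_poly_fourier (p := c) (x := x)).
  apply/funext => q /=; rewrite -sumrB.
  by apply: eq_bigr => k _; rewrite mulrBl.
rewrite -lecR rmorph_sum rmorphD /=.
apply: (@le_trans _ _ (\sum_(0 <= k < K) (`|c`_k| + h%:C))).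
  apply: ler_sum => k _; rewrite -normr_real_complex.
  rewrite -[(a k)%:C](subrK c`_k) (le_trans (ler_normD _ _)) //.
  by rewrite [leLHS]addrC lerD // dh.
rewrite big_split /= lerD //.
  by rewrite (le_trans _ cl) // big_mkord sum_normr_coef_le.
rewrite big_mkord sumr_const card_ord -rmorphMn lecR /h -mulr_natr.
rewrite mulrAC ler_pdivrMr // ler_pM2l // ler_nat //.
Qed.
End Comparison.

(** * Fourier series of signed measures and laws on the naturals *)

Section SignedMeasuresOnNat.
Variable R : realType.

Lemma cvg_complex (u v : nat -> R) (x y : R) :
  u @ \oo --> x -> v @ \oo --> y ->
  ((fun n => u n +i* v n) : nat -> R[i]^o) @ \oo --> (x +i* y : R[i]^o).
Proof.
move=> /cvgrPdist_le ux /cvgrPdist_le vy; apply/cvgrPdist_le => e e0.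
have /complex_realP[d de] : e \is Num.real by rewrite gtr0_real.
have d0 : 0 < d / 2 by rewrite divr_gt0 // -ltcR -de.
near=> n.
apply: (@le_trans _ _ (`|(x - u n) +i* (y - v n)|)); first by [].
rewrite (le_trans (normr_complex_le _ _)) // de lecR [leRHS]splitr lerD //.
  by near: n; exact: ux.
by near: n; exact: vy.
Unshelve. all: by end_near. Qed.

Lemma is_cvg_abs_summable (a f : nat -> R) (A : R) :
  (forall n, \sum_(0 <= k < n) `|a k| <= A) -> (forall k, `|f k| <= 1) ->
  cvgn (series (fun k => a k * f k)).
Proof.
move=> aA f1; apply: normed_cvg; apply: nondecreasing_is_cvgn.
  by apply: nondecreasing_series => k _ _; exact: normr_ge0.
exists A => _ [n _ <-]; apply: le_trans (aA n); apply: ler_sum => k _.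
by rewrite /= normrM ler_piMr.
Qed.

Lemma sum_expiE (a : nat -> R) (x : R) n :
  \sum_(0 <= k < n) (a k)%:C * expi (k%:R * x) =
  series (fun k => a k * cos (k%:R * x)) n +i*
  series (fun k => a k * sin (k%:R * x)) n.
Proof.
rewrite /series /=; elim: n => [|n IH]; first by rewrite !big_geq.
rewrite !big_nat_recr //= IH expiE; apply/eqP; rewrite eq_complex /=.
by apply/andP; split; apply/eqP; ring.
Qed.

Lemma cvg_fourier_series (a : nat -> R) (A x : R) :
  (forall n, \sum_(0 <= k < n) `|a k| <= A) ->
  ((fun n => \sum_(0 <= k < n) (a k)%:C * expi (k%:R * x)) : nat -> R[i]^o) @ \oo
  --> (limn (series (fun k => a k * cos (k%:R * x))) +i*
       limn (series (fun k => a k * sin (k%:R * x))) : R[i]^o).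
Proof.
move=> aA; rewrite [X in X @ _ --> _](_ : _ = (fun n =>
  series (fun k => a k * cos (k%:R * x)) n +i*
  series (fun k => a k * sin (k%:R * x)) n)); last first.
  by apply/funext => n; rewrite sum_expiE.
by apply: cvg_complex; apply: (is_cvg_abs_summable aA) => k;
  rewrite ?cos_max ?sin_max.
Qed.

(** Countable additivity bounds the sum of the atoms of one sign by the measure
    of the set they form, which is finite. *)
Lemma charge_abs_summable (nu : {charge set nat -> \bar R}) :
  exists A : R, forall n, \sum_(0 <= k < n) `|fine (nu [set k])| <= A.
Proof.
have part (S : pred nat) :
    (fun n => \sum_(0 <= k < n) (if S k then fine (nu [set k]) else 0)) @ \oo
      --> fine (nu [set k | S k]).
  pose F k : set nat := if S k then [set k] else set0.
  have FS : \bigcup_k F k = [set k | S k].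
    apply/seteqP; split=> k /=.
      by case=> j _; rewrite /F; case: ifP => // Sj /= ->.
    by move=> Sk; exists k => //; rewrite /F Sk.
  have tF : trivIset setT F.
    apply/trivIsetP => i j _ _ ij; rewrite /F.
    case: (S i) (S j) => [] []; rewrite ?setI0 ?set0I //.
    by apply/seteqP; split=> // k /= [-> /eqP]; rewrite (negbTE ij).
  have := @charge_semi_sigma_additive _ _ _ nu F (fun _ => I) tF I.
  rewrite FS -(fineK (fin_num_measure nu _ I)) => /fine_cvg.
  apply: cvg_trans; apply: near_eq_cvg; near=> n.
  rewrite /= (_ : \sum_(0 <= k < n) nu (F k) =
    \sum_(0 <= k < n) (if S k then fine (nu [set k]) else 0)%:E)%E.
    by rewrite sumEFin.
  apply: eq_bigr => k _; rewrite /F; case: (S k).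
    by rewrite fineK // fin_num_measure.
  by rewrite charge0.
pose S k := 0 <= fine (nu [set k]).
have P := part S; have N := part (predC S).
exists (fine (nu [set k | S k]) - fine (nu [set k | predC S k])) => n.
have -> : \sum_(0 <= k < n) `|fine (nu [set k])| =
    \sum_(0 <= k < n) (if S k then fine (nu [set k]) else 0) -
    \sum_(0 <= k < n) (if predC S k then fine (nu [set k]) else 0).
  rewrite -sumrB; apply: eq_bigr => k _ /=; rewrite /S.
  by case: leP => h /=; [rewrite subr0 ger0_norm | rewrite sub0r ltr0_norm].
apply: lerB.
  rewrite -(cvg_lim _ P) //; apply: nondecreasing_cvgn_le; last first.
    by apply/cvg_ex; eexists; exact: P.
  move=> i j ij; rewrite (big_cat_nat _ ij) //= lerDl.
  by apply: sumr_ge0 => k _; case: ifP.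
rewrite -(cvg_lim _ N) //; apply: nonincreasing_cvgn_ge; last first.
  by apply/cvg_ex; eexists; exact: N.
move=> i j ij; rewrite (big_cat_nat _ ij) //= gerDl.
by apply: sumr_le0 => k _; case: ifP => //; rewrite /S -ltNge => /ltW.
Unshelve. all: by end_near. Qed.

Lemma cvg_fourier (nu : {charge set nat -> \bar R}) (x : R) :
  ((fun n => \sum_(0 <= k < n) (fine (nu [set k]))%:C * expi (k%:R * x))
    : nat -> R[i]^o) @ \oo --> (fourier nu x : R[i]^o).
Proof.
have [A nuA] := charge_abs_summable nu.
have cv := cvg_fourier_series (x := x) nuA.
by rewrite /fourier (cvg_lim _ cv).
Qed.

Lemma probability_nat_summable (p : probability nat R) n :
  \sum_(0 <= k < n) `|fine (p [set k])| <= 1.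
Proof.
have -> : \sum_(0 <= k < n) `|fine (p [set k])| =
    fine (p (\big[setU/set0]_(k < n) [set (k : nat)])).
  rewrite big_mkord measure_bigsetU //; last first.
    apply/trivIsetP => i j _ _ ij; apply/seteqP; split=> // k /= [-> /eqP].
    by rewrite (negbTE ij).
  rewrite -sum_fine; last by move=> k _; rewrite fin_num_measure.
  by apply: eq_bigr => k _; rewrite ger0_norm // fine_ge0.
by rewrite -lee_fin fineK ?fin_num_measure // probability_le1.
Qed.

Lemma expectation_nat_series d (T : measurableType d) (P : probability T R)
    (X : {RV P >-> nat}) (f : nat -> R) : (forall k, `|f k| <= 1) ->
  fine 'E_P[fun w => f (X w)] =
  limn (series (fun k => fine (distribution P X [set k]) * f k)).
Proof.
move=> f1; rewrite unlock.
pose F k := X @^-1` [set k].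
have mF k : measurable (F k).
  by rewrite -[F k]setTI; exact: (measurable_funPT X).
have FT : \bigcup_k F k = setT.
  by apply/seteqP; split=> // w _; exists (X w).
have tF : trivIset setT F.
  apply/trivIsetP => i j _ _ ij; apply/seteqP; split=> // w [Xi Xj].
  by move: ij; rewrite -Xi -Xj eqxx.
have intf : P.-integrable setT (EFin \o (f \o X)).
  apply: measurable_bounded_integrable => //.
  - exact: le_lt_trans (probability_le1 P measurableT) (ltry 1).
  - exact: (measurableT_comp (f := f)).
  - exists 1; split=> // M M1 w _ /=; exact: le_trans (f1 _) (ltW M1).
have /(_ (EFin \o (f \o X))) := @integral_bigcup _ _ _ P F _ tF mF.
rewrite FT => /(_ intf) => int_atoms.
rewrite [X in fine X]int_atoms.
have -> : (\sum_(0 <= k <oo) \int[P]_(w in F k) (EFin \o (f \o X)) w)%E =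
    limn (EFin \o series (fun k => fine (distribution P X [set k]) * f k)).
  congr (limn _); apply/funext => n; rewrite /= /series /= -sumEFin.
  apply: eq_bigr => k _.
  rewrite (eq_integral (cst (f k)%:E)); last by move=> w; rewrite inE => /= ->.
  rewrite integral_cst // mulrC EFinM fineK //.
  exact: fin_num_measure.
rewrite EFin_lim //.
exact: (is_cvg_abs_summable (probability_nat_summable (distribution P X))).
Qed.

Lemma cvg_cexpectation d (T : measurableType d) (P : probability T R)
    (X : {RV P >-> nat}) (x : R) :
  ((fun n => \sum_(0 <= k < n) (fine (distribution P X [set k]))%:C * expi (k%:R * x))
    : nat -> R[i]^o) @ \oo -->
  (cexpectation P (fun w => expi (x * (X w)%:R)) : R[i]^o).
Proof.
have := cvg_fourier_series (x := x) (probability_nat_summable (distribution P X)).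
rewrite -(@expectation_nat_series _ _ _ X (fun k => cos (k%:R * x))); last first.
  by move=> k; exact: cos_max.
rewrite -(@expectation_nat_series _ _ _ X (fun k => sin (k%:R * x))); last first.
  by move=> k; exact: sin_max.
rewrite /cexpectation.
have -> : (fun w => cos ((X w)%:R * x)) = fun w => complex.Re (expi (x * (X w)%:R)).
  by apply/funext => w; rewrite expiE mulrC.
have -> : (fun w => sin ((X w)%:R * x)) = fun w => complex.Im (expi (x * (X w)%:R)).
  by apply/funext => w; rewrite expiE mulrC.
by [].
Qed.

Lemma dTV_le (mu nu : set nat -> \bar R) (B : R) :
  (forall k, mu [set k] \is a fin_num) -> (forall k, nu [set k] \is a fin_num) ->
  (forall n, \sum_(0 <= k < n) `|fine (mu [set k]) - fine (nu [set k])| <= B) ->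
  (dTV mu nu <= (2^-1 * B)%:E)%E.
Proof.
move=> fmu fnu sB; rewrite /dTV EFinM lee_pmul2l //.
apply: lime_le; first exact: is_cvg_nneseries.
apply: nearW => n.
rewrite (eq_bigr (fun k => (`|fine (mu [set k]) - fine (nu [set k])|)%:E)).
  by rewrite sumEFin lee_fin.
by move=> k _; rewrite -{1}(fineK (fmu k)) -{1}(fineK (fnu k)).
Qed.
End SignedMeasuresOnNat.

(** * The total variation bound *)

(** Multiplying the expansion of [residue_expansion] by [e^{lambda z}] turns it
    into an expansion of the transform of the law of [X], from which that of [nu]
    removes the terms up to [r]; [l1_le_of_fourier] applies to the difference of
    the atoms. *)
Lemma TV_bound_one_four (R : realType) : TV_bound (1 : R) 4.
Proof.
move=> d T P X lambda tau b r nu l0 t0 [cvE b_le] r1 scheme eps1.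
have [A nuA] := charge_abs_summable nu.
have muA := probability_nat_summable (distribution P X).
have sl0 : 0 < Num.sqrt lambda by rewrite sqrtr_gt0.
pose a k := fine (distribution P X [set k]) - fine (nu [set k]).
have aA n : \sum_(0 <= k < n) `|a k| <= 1 + A.
  rewrite (le_trans _ (lerD (muA n) (nuA n))) // -big_split /=.
  by apply: ler_sum => k _; exact: ler_normB.
have cva x : ((fun n : nat => \sum_(0 <= k < n) (a k)%:C * expi (k%:R * x))
      : nat -> R[i]^o) @ \oo -->
    (cexp (lambda%:C * (expi x - 1)) *
      (cexpectation P (fun w => expi (x * (X w)%:R)) *
         cexp (- (lambda%:C * (expi x - 1))) -
       (1 + \sum_(2 <= s < r.+1) b s * (expi x - 1) ^+ s)) : R[i]^o).
  rewrite mulrBr mulrCA [cexp _ * cexp _]mulrC cexpNK mulr1 -scheme.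
  rewrite [X in X @ _ --> _](_ : _ = (fun n : nat =>
    (\sum_(0 <= k < n) (fine (distribution P X [set k]))%:C *
       expi (k%:R * x) : R[i]^o) -
     \sum_(0 <= k < n) (fine (nu [set k]))%:C * expi (k%:R * x))).
    exact: cvgB (cvg_cexpectation (X := X) (x := x)) (cvg_fourier (nu := nu) (x := x)).
  apply/funext => n /=; rewrite -sumrB; apply: eq_bigr => k _.
  by rewrite /a rmorphB mulrBl.
have l1 := l1_le_of_fourier l0 t0 b_le r1 eps1 aA cvE cva.
rewrite (le_trans (dTV_le _ _ l1)) //.
- by move=> k; exact: fin_num_measure.
- by move=> k; exact: fin_num_measure.
rewrite lee_fin mulKf ?pnatr_eq0 // mul1r.
rewrite lerXn2r ?nnegrE ?divr_ge0 ?mulr_ge0 ?(ltW t0) ?(ltW sl0) //.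
by rewrite ler_pM2r ?invr_gt0 // ler_pM2r // ler_nat.
Qed.

Theorem theorem1 (R : realType) :
  (exists C D : R, [/\ 0 < C, 0 < D & TV_bound C D]) /\
  (exists C : R, [/\ 0 < C, C <= 570 & TV_bound C 4]).
Proof.
split; first by exists 1, 4; split => //; exact: TV_bound_one_four.
by exists 1; split; rewrite ?ler1n //; exact: TV_bound_one_four.
Qed.
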